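(* Let $n$ be any positive integer. Then every maximal subgroup of $\mathscr{IPF}(\mathbb{N}^n)$ is isomorphic to the symmetric group $\mathscr{S}_n$, and every $\mathscr{H}$-class of $\mathscr{IPF}(\mathbb{N}^n)$ consists of $n!$ elements.
   Context: $\mathbb{N}$ is the set of positive integers; $(\mathbb{N}^n,\leqslant)$ carries the product (coordinatewise) order; ${\uparrow}\mathbf{x}=\{\mathbf{y}\in\mathbb{N}^n:\mathbf{x}\leqslant\mathbf{y}\}$ is the principal filter generated by $\mathbf{x}$. $\mathscr{IPF}(\mathbb{N}^n)$ is the semigroup of all order isomorphisms between principal filters of $(\mathbb{N}^n,\leqslant)$, with composition of partial maps (maps written on the right, composed left to right, $z(\alpha\beta)=(z\alpha)\beta$ wherever defined). $\mathscr{H}$ is Green's relation: $a\mathscr{H}b$ in a semigroup $S$ iff $aS^1=bS^1$ and $S^1a=S^1b$. $\mathscr{S}_n$ is the group of all permutations of an $n$-element set. *)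

(* Defs.v *)
From HB Require Import structures.
From mathcomp Require Import all_boot all_order all_fingroup.
From mathcomp Require Import boolp classical_sets functions cardinality.

Set Implicit Arguments.
Unset Strict Implicit.
Unset Printing Implicit Defensive.

Import Order.TTheory.
Local Open Scope order_scope.
Local Open Scope classical_set_scope.

Record posnat : Type := PosNat {posnat_val :> nat; _ : (0 < posnat_val)%N}.

HB.instance Definition _ := [isSub for posnat_val].
HB.instance Definition _ := [Choice of posnat by <:].
HB.instance Definition _ := 
  [SubChoice_isSubOrder of posnat by <: with Order.NatOrder.nat_display].

Section PartialMaps.
Context {T : Type}.
Implicit Types f g : T -> option T.

Definition pdom f : set T := [set a | f a].
Definition pran f : set T := [set b | exists a, f a = Some b].

(* Maps are written on the right: a(fg) = (af)g, so [f] is applied first. *)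
Definition pmul f g : T -> option T := fun a => obind g (f a).

End PartialMaps.

Section PrincipalFilterIsomorphisms.
Context {d : Order.disp_t} {L : joinSemilatticeType d}.
Implicit Types (x y : L) (f g : L -> option L).

Definition principal_filter x : set L := [set y | x <= y].

(* Injectivity follows from the last clause by antisymmetry. *)
Definition filter_iso f x y : Prop :=
  [/\ pdom f = principal_filter x, pran f = principal_filter y
    & forall a1 a2 b1 b2, f a1 = Some b1 -> f a2 = Some b2 ->
        (b1 <= b2) = (a1 <= a2)].

Definition is_ipf f : Prop := exists x y, filter_iso f x y.

(* The filters of [x] and [y] always meet, in the filter of the join of
   [x] and [y], so a composition is never the empty map. *)
Lemma is_ipf_mul f g : is_ipf f -> is_ipf g -> is_ipf (pmul f g).
Proof.
move=> [x [y [fd fr fm]]] [u [v [gd gr gm]]].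
have pdomE k z : pdom k = principal_filter z ->
    forall a, k a = (z <= a) :> bool.
  move=> kz a; apply/idP/idP => [ka|za].
    by have : pdom k a := ka; rewrite kz.
  by have : principal_filter z a := za; rewrite -kz.
have pranE k z : pran k = principal_filter z ->
    forall a b, k a = Some b -> z <= b.
  move=> kz a b ab; have : pran k b by exists a.
  by rewrite kz.
have fdE := pdomE _ _ fd; have gdE := pdomE _ _ gd.
have fran := pranE _ _ fr; have gran := pranE _ _ gr.
have [x' x'E] : pran f (y `|` u)%O by rewrite fr; exact: leUl.
have := gdE (y `|` u)%O; rewrite leUr; case v'E: (g _) => [v'|//] _.
exists x', v'; split.
- apply/seteqP; split=> a; rewrite /pdom /principal_filter /pmul /=.
    case fa: (f a) => [b|//] /=; rewrite gdE => ub.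
    by rewrite -(fm _ _ _ _ x'E fa) leUx ub (fran _ _ fa).
  move=> x'a; have : f a by rewrite fdE; apply: le_trans x'a; rewrite -fdE x'E.
  case fa: (f a) => [b|//] _ /=.
  by move: x'a; rewrite -(fm _ _ _ _ x'E fa) gdE leUx => /andP[].
- apply/seteqP; split=> c; rewrite /pran /principal_filter /pmul /=.
    move=> [a]; case fa: (f a) => [b|//] /= gb.
    by rewrite (gm _ _ _ _ v'E gb) leUx (fran _ _ fa) -gdE gb.
  move=> v'c; have [b gb] : pran g c.
    by rewrite gr; apply: le_trans v'c; exact: gran v'E.
  move: v'c; rewrite (gm _ _ _ _ v'E gb) leUx => /andP[yb ub].
  by have [a fa] : pran f b by [rewrite fr]; exists a; rewrite fa.
- move=> a1 a2 c1 c2; rewrite /pmul.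
  case fa1: (f a1) => [b1|//] /= gb1; case fa2: (f a2) => [b2|//] /= gb2.
  by rewrite (gm _ _ _ _ gb1 gb2) (fm _ _ _ _ fa1 fa2).
Qed.

End PrincipalFilterIsomorphisms.

Record ipf {d : Order.disp_t} (L : joinSemilatticeType d) : Type :=
  Ipf {ipf_fun :> L -> option L; ipf_funP : is_ipf ipf_fun}.

Section IpfSemigroup.
Context {d : Order.disp_t} {L : joinSemilatticeType d}.
Implicit Types f g h : ipf L.

Lemma ipf_eqP f g : ipf_fun f = ipf_fun g -> f = g.
Proof.
case: f g => [f fP] [g gP] /= fg; case: g / fg gP => gP.
by congr Ipf; exact: Prop_irrelevance.
Qed.

Definition ipf_mul f g : ipf L := Ipf (is_ipf_mul (ipf_funP f) (ipf_funP g)).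

Lemma ipf_mulA : associative ipf_mul.
Proof.
move=> f g h; apply: ipf_eqP; apply/funext => a /=; rewrite /pmul /=.
by case: (f a).
Qed.

HB.instance Definition _ := gen_eqMixin (ipf L).
HB.instance Definition _ := gen_choiceMixin (ipf L).
HB.instance Definition _ := isSemigroup.Build (ipf L) ipf_mulA.

End IpfSemigroup.

(* IPF(N^n), for the product order on N^n. *)
Definition IPF (n : nat) : semigroupType := ipf (n.-tupleprod posnat).

Section Semigroups.
Context {S : semigroupType}.
Implicit Types (a b e : S) (G H : set S).
Local Open Scope group_scope.

(* The one-sided ideals a S^1 and S^1 a, where S^1 is S with an identity
   adjoined if it has none. *)
Definition rideal a : set S := [set x | x = a \/ exists s, x = a * s].
Definition lideal a : set S := [set x | x = a \/ exists s, x = s * a].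

Definition greenH a b : Prop := rideal a = rideal b /\ lideal a = lideal b.

Definition Hclass a : set S := [set b | greenH a b].

(* Being closed, [G] is a group for the product of [S]; its identity [e] is an
   idempotent that need not be an identity of [S]. *)
Definition is_subgroup G : Prop :=
  (forall a b, G a -> G b -> G (a * b)) /\
  exists2 e, G e & forall a, G a ->
    [/\ e * a = a, a * e = a & exists2 b, G b & a * b = e /\ b * a = e].

Definition is_maximal_subgroup G : Prop :=
  is_subgroup G /\ forall H, is_subgroup H -> G `<=` H -> H = G.

Definition isomorphic_to G (M : magmaType) : Prop :=
  exists f : M -> S, {morph f : x y / x * y} /\ set_bij [set: M] G f.

End Semigroups.

(* Main.v *)
Require Import Defs.
From mathcomp Require Import all_boot all_order all_fingroup.
From mathcomp Require Import boolp classical_sets functions cardinality.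

(**
  Translating filters to the origin turns an order isomorphism between two
  principal filters into an order automorphism of the product of [n] copies
  of the nonnegative integers.  Such an automorphism permutes the atoms, hence
  the axes, is the identity along each axis, and therefore permutes
  coordinates.  So the isomorphisms between two given filters are indexed by
  ['S_n].  Two elements are H-related exactly when they have the same domain
  and the same range; and a maximal subgroup is the H-class of its identity,
  which is an idempotent, that is, the identity map of a filter.
*)

Set Implicit Arguments.
Unset Strict Implicit.
Unset Printing Implicit Defensive.

Import Order.TTheory.
Local Open Scope order_scope.
Local Open Scope card_scope.

(** * Multiples of the atoms of the product of copies of [nat] *)

Section AxisVectors.
Context {n : nat}.
Implicit Types (v w : n.-tupleprod nat) (i j : 'I_n) (k : nat).

Definition axis i k : n.-tupleprod nat :=
  [tuple if j == i then k else 0%N | j < n].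

Lemma axis_le i k v : (axis i k <= v) = (k <= tnth v i)%N.
Proof.
rewrite leEtprod; apply/forallP/idP => [/(_ i)|kv j].
  by rewrite tnth_mktuple eqxx.
by rewrite tnth_mktuple; case: eqP => // ->.
Qed.

Lemma le_axis i k v :
  (v <= axis i k) =
  (tnth v i <= k)%N && [forall j, (j != i) ==> (tnth v j == 0%N)].
Proof.
rewrite leEtprod; apply/forallP/andP => [vk|[vi /forallP v0] j].
  split; first by have := vk i; rewrite tnth_mktuple eqxx.
  apply/forallP => j; apply/implyP => /negPf ji.
  by have := vk j; rewrite tnth_mktuple ji leEnat leqn0.
rewrite tnth_mktuple; case: eqP => [-> //|/eqP ji].
by rewrite leEnat leqn0 (implyP (v0 j)).
Qed.

Lemma axis_le_axis i j k : (axis i k.+1 <= axis j k.+1) = (i == j).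
Proof. by rewrite axis_le tnth_mktuple; case: eqP => // _; exact: leqnn. Qed.

Lemma axis1_inj i j : axis i 1 = axis j 1 -> i = j.
Proof. by move=> ij; apply/eqP; rewrite -(axis_le_axis i j 0) ij. Qed.

End AxisVectors.

(** * Order automorphisms permute coordinates *)

Section OrderAutomorphism.
Context {n : nat}.
Implicit Types (v : n.-tupleprod nat) (i j : 'I_n) (k : nat).

(** The inverse is named so that every result on [f] can also be applied to [g]. *)
Definition order_aut (f g : n.-tupleprod nat -> n.-tupleprod nat) : Prop :=
  [/\ {mono f : v w / v <= w}, cancel f g & cancel g f].

Lemma order_aut_galois f g v w : order_aut f g -> (f v <= w) = (v <= g w).
Proof. by case=> fm fK gK; rewrite -{1}(gK w) fm. Qed.

Lemma order_aut_sym f g : order_aut f g -> order_aut g f.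
Proof.
by move=> [fm fK gK]; split=> // v w; rewrite -{2}(gK v) -{2}(gK w) fm.
Qed.

Lemma order_aut_above_atom f g i :
  order_aut f g -> exists j, axis j 1 <= f (axis i 1).
Proof.
move=> fg; apply: contrapT => no_atom.
(* With no atom below it, [f (axis i 1)] is zero; but [f] reflects the order, and [axis i 1] is not
   below the zero vector [axis i 0]. *)
have : f (axis i 1) <= f (axis i 0).
  rewrite leEtprod; apply/forallP => j; rewrite leEnat.
  case: (posnP (tnth (f (axis i 1)) j)) => [-> //|gt0].
  by case: no_atom; exists j; rewrite axis_le.
by case: fg => -> _ _; rewrite axis_le tnth_mktuple eqxx.
Qed.

Lemma order_aut_atom f g i :
  order_aut f g -> exists j, f (axis i 1) = axis j 1.
Proof.
move=> fg; have [j jf] := order_aut_above_atom i fg; exists j.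
apply/le_anti; rewrite jf (order_aut_galois _ _ fg) andbT.
(* Some atom lies below [g (axis j 1)], which lies below [axis i 1]. Comparable atoms are equal, so
   [axis i 1] itself lies below [g (axis j 1)]. *)
have [i' i'g] := order_aut_above_atom j (order_aut_sym fg).
suff /eqP <- : i' == i by [].
rewrite -(axis_le_axis _ _ 0); apply: le_trans i'g _.
by rewrite (order_aut_galois _ _ (order_aut_sym fg)).
Qed.

Lemma order_aut_le_axis f g i j k :
  order_aut f g -> f (axis i 1) = axis j 1 -> axis j k <= f (axis i k).
Proof.
move=> fg fij; have [fm fK gK] := fg; elim: k => [|k IHk].
  by rewrite axis_le.
rewrite axis_le leqNgt ltnS; apply/negP => small.
(* Coordinates other than [j] vanish: an atom [axis j' 1] below [f (axis i k.+1)] is the image of an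
   atom below [axis i k.+1], hence of [axis i 1], so [j' = j]. *)
have : f (axis i k.+1) <= axis j k.
  rewrite le_axis small; apply/forallP => j'; apply/implyP.
  apply: contraNT; rewrite -lt0n -(axis_le j' 1).
  have [i' gj'] := order_aut_atom j' (order_aut_sym fg).
  rewrite -(gK (axis j' 1)) gj' fm axis_le tnth_mktuple.
  case: eqP => // ii' _; apply/eqP/axis1_inj.
  by rewrite -fij -ii' -gj' gK.
move=> /le_trans /(_ IHk); rewrite fm axis_le tnth_mktuple eqxx.
by rewrite ltnn.
Qed.

Lemma order_aut_axis f g i j k :
  order_aut f g -> f (axis i 1) = axis j 1 -> f (axis i k) = axis j k.
Proof.
move=> fg fij; apply/le_anti; rewrite (order_aut_le_axis _ fg) // andbT.
rewrite (order_aut_galois _ _ fg).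
apply: order_aut_le_axis (order_aut_sym fg) _.
by case: fg => _ fK _; rewrite -fij fK.
Qed.

(** Coordinate [i] of [v] is the largest [k] with [axis i k <= v], and [f] carries these
    inequalities to those on axis [s i]. *)
Lemma order_aut_perm f g :
  order_aut f g -> exists s : 'S_n, forall v i, tnth (f v) (s i) = tnth v i.
Proof.
move=> fg; have [fm fK gK] := fg.
have [s fs] := choice (fun i => order_aut_atom i fg).
have s_inj : injective s.
  by move=> i j sij; apply/axis1_inj/(can_inj fK); rewrite !fs sij.
exists (perm s_inj) => v i; rewrite permE.
have eq_le k : (k <= tnth (f v) (s i))%N = (k <= tnth v i)%N.
  by rewrite -!axis_le -(order_aut_axis k fg (fs i)) fm.
by apply/eqP; rewrite eqn_leq -eq_le leqnn eq_le leqnn.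
Qed.

End OrderAutomorphism.

(** * Translation between principal filters and the filter at the origin *)

Section Shifts.
Context {n : nat}.
Implicit Types (v w : n.-tupleprod nat) (x y a b : n.-tupleprod posnat).

Lemma posnat_addn_gt0 (p : posnat) k : (0 < p + k)%N.
Proof. by rewrite addn_gt0 (valP p). Qed.

Definition shift x v : n.-tupleprod posnat :=
  [tuple PosNat (posnat_addn_gt0 (tnth x i) (tnth v i)) | i < n].

(* Truncated subtraction: only meaningful for [x <= a]. *)
Definition unshift x a : n.-tupleprod nat :=
  [tuple (tnth a i - tnth x i)%N | i < n].

Lemma posnat_leE (p q : posnat) : (p <= q) = (p <= q)%N.
Proof. by rewrite -Order.le_val leEnat. Qed.

Lemma shiftK x : cancel (shift x) (unshift x).
Proof.
by move=> v; apply: eq_from_tnth => i; rewrite !tnth_mktuple /= addKn.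
Qed.

Lemma unshiftK x a : x <= a -> shift x (unshift x a) = a.
Proof.
rewrite leEtprod => /forallP xa; apply: eq_from_tnth => i.
apply: val_inj; rewrite !tnth_mktuple /= subnKC //.
by rewrite -posnat_leE.
Qed.

Lemma shift_le x : {mono shift x : v w / v <= w}.
Proof.
move=> v w; rewrite !leEtprod; apply: eq_forallb => i.
by rewrite !tnth_mktuple posnat_leE /= leq_add2l leEnat.
Qed.

Lemma le_shift x v : x <= shift x v.
Proof.
rewrite leEtprod; apply/forallP => i.
by rewrite tnth_mktuple posnat_leE /= leq_addr.
Qed.

End Shifts.

(** * Filter isomorphisms induced by permutations *)

Section CoordinatePermutations.
Context {n : nat}.
Implicit Types (v w : n.-tupleprod nat) (x y z a b : n.-tupleprod posnat).
Implicit Types (s t : 'S_n) (i : 'I_n).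

(** The entry at [i] moves to place [s i]; the inverse makes this an action for products of
    permutations read left to right. *)
Definition permute_coords s v : n.-tupleprod nat :=
  [tuple tnth v ((s^-1)%g i) | i < n].

Lemma permute_coordsM s t v :
  permute_coords (s * t)%g v = permute_coords t (permute_coords s v).
Proof.
by apply: eq_from_tnth => i; rewrite !tnth_mktuple invMg permM.
Qed.

Lemma permute_coords1 v : permute_coords 1%g v = v.
Proof. by apply: eq_from_tnth => i; rewrite tnth_mktuple invg1 perm1. Qed.

Lemma permute_coords_axis s i k :
  permute_coords s (axis i k) = axis (s i) k.
Proof.
apply: eq_from_tnth => j; rewrite !tnth_mktuple.
by rewrite -(inj_eq (@perm_inj _ s)) permKV.
Qed.

Lemma permute_coordsK s : cancel (permute_coords s) (permute_coords s^-1%g).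
Proof. by move=> v; rewrite -permute_coordsM mulgV permute_coords1. Qed.

Lemma permute_coordsKV s : cancel (permute_coords s^-1%g) (permute_coords s).
Proof. by move=> v; rewrite -permute_coordsM mulVg permute_coords1. Qed.

Lemma permute_coords_homo s : {homo permute_coords s : v w / v <= w}.
Proof.
move=> v w; rewrite !leEtprod => /forallP vw; apply/forallP => i.
by rewrite !tnth_mktuple.
Qed.

Lemma permute_coords_le s : {mono permute_coords s : v w / v <= w}.
Proof.
move=> v w; apply/idP/idP => [|/permute_coords_homo //].
by move=> /(permute_coords_homo s^-1%g); rewrite !permute_coordsK.
Qed.

Definition perm_iso_fun x y s a : option (n.-tupleprod posnat) :=
  if x <= a then Some (shift y (permute_coords s (unshift x a))) else None.

Lemma perm_iso_fun_shift x y s v :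
  perm_iso_fun x y s (shift x v) = Some (shift y (permute_coords s v)).
Proof. by rewrite /perm_iso_fun le_shift shiftK. Qed.

Lemma perm_iso_fun_Some x y s a b :
  perm_iso_fun x y s a = Some b ->
  exists2 v, a = shift x v & b = shift y (permute_coords s v).
Proof.
rewrite /perm_iso_fun; case: ifP => // xa [<-].
by exists (unshift x a); rewrite ?unshiftK.
Qed.

Lemma filter_iso_perm x y s : filter_iso (perm_iso_fun x y s) x y.
Proof.
split.
- apply/seteqP; split=> a; rewrite /pdom /principal_filter /perm_iso_fun /=;
    by case: ifP.
- apply/seteqP; split=> b; rewrite /pran /principal_filter /=.
    by move=> [a /perm_iso_fun_Some[v _ ->]]; exact: le_shift.
  move=> yb; exists (shift x (permute_coords s^-1%g (unshift y b))).
  by rewrite perm_iso_fun_shift permute_coordsKV unshiftK.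
- move=> a1 a2 b1 b2 /perm_iso_fun_Some[v -> ->] /perm_iso_fun_Some[w -> ->].
  by rewrite !shift_le permute_coords_le.
Qed.

Definition perm_iso x y s : IPF n :=
  Ipf (ex_intro _ x (ex_intro _ y (filter_iso_perm x y s))).

Lemma perm_isoM x y z s t :
  (perm_iso x y s * perm_iso y z t)%g = perm_iso x z (s * t)%g.
Proof.
apply: ipf_eqP; apply/funext => a /=; rewrite /pmul {2 3}/perm_iso_fun.
case: ifP => //= xa.
by rewrite perm_iso_fun_shift permute_coordsM.
Qed.

(** The images of the translated atoms determine the permutation. *)
Lemma perm_iso_inj x y : injective (perm_iso x y).
Proof.
move=> s t st; apply/permP => i; apply/axis1_inj.
rewrite -!permute_coords_axis; apply/(can_inj (shiftK y))/Some_inj.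
rewrite -!(perm_iso_fun_shift x).
by have /(congr1 (fun h : IPF n => ipf_fun h (shift x (axis i 1)))) := st.
Qed.

End CoordinatePermutations.

(** * Every filter isomorphism comes from a permutation *)

Section FilterIsomorphisms.
Context {d : Order.disp_t} {L : joinSemilatticeType d}.
Implicit Types (x y a b : L) (f : L -> option L).

Lemma filter_iso_dom f x y a : filter_iso f x y -> f a = (x <= a) :> bool.
Proof.
move=> [fd _ _]; apply/idP/idP => [fa|xa].
  by have : pdom f a := fa; rewrite fd.
by have : principal_filter x a := xa; rewrite -fd.
Qed.

Lemma filter_iso_ran f x y a b : filter_iso f x y -> f a = Some b -> y <= b.
Proof. by move=> [_ fr _] fa; have : pran f b by [exists a]; rewrite fr. Qed.

Lemma filter_iso_onto f x y b :
  filter_iso f x y -> y <= b -> exists a, f a = Some b.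
Proof. by move=> [_ fr _] yb; have : pran f b by rewrite fr. Qed.

End FilterIsomorphisms.

Lemma filter_isoE {n : nat} (x y : n.-tupleprod posnat) f :
  filter_iso f x y -> exists s, f = perm_iso_fun x y s.
Proof.
move=> fxy; have [_ _ fm] := fxy.
(* [F] is [f] conjugated by the two translations, and [G] below will be its inverse. *)
have /choice[F fF] v : exists w, f (shift x v) = Some (shift y w).
  have := filter_iso_dom (shift x v) fxy.
  rewrite le_shift; case fv: (f _) => [b|//] _; exists (unshift y b).
  by rewrite unshiftK // (filter_iso_ran fxy fv).
have /choice[G fG] w : exists v, f (shift x v) = Some (shift y w).
  have [a fa] := filter_iso_onto fxy (le_shift y w).
  exists (unshift x a); rewrite unshiftK // -(filter_iso_dom _ fxy).
  by rewrite fa.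
have Fm : {mono F : v w / v <= w}.
  by move=> v w; rewrite -(shift_le y) (fm _ _ _ _ (fF v) (fF w)) shift_le.
have GK : cancel G F.
  by move=> w; apply/(can_inj (shiftK y))/Some_inj; rewrite -fF fG.
have FK : cancel F G.
  (* [F] is injective because it reflects the order, so its right inverse [G] is also a left
     inverse. *)
  by move=> v; apply: (mono_inj lexx le_anti Fm); rewrite GK.
have [s Fs] := order_aut_perm (And3 Fm FK GK).
exists s; apply/funext => a; rewrite /perm_iso_fun; case: ifPn => xa.
  rewrite -{1}(unshiftK xa) fF; congr (Some (shift y _)).
  by apply: eq_from_tnth => i; rewrite tnth_mktuple -{1}(permKV s i) Fs.
by have := filter_iso_dom a fxy; rewrite (negPf xa); case: (f a).
Qed.

Lemma perm_isoE {n : nat} (a : IPF n) : exists x y s, a = perm_iso x y s.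
Proof.
have [x [y fxy]] := ipf_funP a; have [s as_] := filter_isoE fxy.
by exists x, y, s; apply: ipf_eqP.
Qed.

(** * Domains and ranges of H-related elements and of idempotents *)

Section GreenH.
Context {d : Order.disp_t} {L : joinSemilatticeType d}.
Implicit Types a b e : ipf L.

(** The left factor is applied first, so a product is defined only where that factor is. *)
Lemma rideal_pdom a b : rideal b a -> (pdom a `<=` pdom b)%classic.
Proof.
move=> [->//|[c ->]] z; rewrite /pdom /= /pmul.
by case: (ipf_fun b z).
Qed.

Lemma lideal_pran a b : lideal b a -> (pran a `<=` pran b)%classic.
Proof.
move=> [->//|[c ->]] z [w]; rewrite /pran /= /pmul.
by case: (ipf_fun c w) => //= u bu; exists u.
Qed.

Lemma greenH_filter_iso a b x y :
  greenH a b -> filter_iso a x y -> filter_iso b x y.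
Proof.
move=> [rab lab] [ad ar _].
have [u [v [bd br bm]]] := ipf_funP b.
have [ra rb] : rideal b a /\ rideal a b by split; [rewrite -rab|rewrite rab]; left.
have [la lb] : lideal b a /\ lideal a b by split; [rewrite -lab|rewrite lab]; left.
split=> //.
- by rewrite -ad; apply/seteqP; split; apply: rideal_pdom.
- by rewrite -ar; apply/seteqP; split; apply: lideal_pran.
Qed.

Lemma ipf_idem e : (e * e)%g = e -> exists x, filter_iso e x x.
Proof.
move=> ee; have [x [y exy]] := ipf_funP e; have [ed er em] := exy.
(* An idempotent fixes its values, so [u] and [v] have the same image; reflecting the order then
   forces [u = v]. *)
have e_id (u v : L) : ipf_fun e u = Some v -> u = v.
  move=> ea; have eb : ipf_fun e v = Some v.
    by rewrite -[in RHS]ea -[in RHS]ee /= /pmul /= ea.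
  by apply/le_anti; rewrite -(em _ _ _ _ ea eb) -(em _ _ _ _ eb ea) lexx.
exists x; split=> //; rewrite -ed; apply/seteqP; split=> b.
  by move=> [a ea]; rewrite /pdom /= -(e_id _ _ ea) ea.
rewrite /pdom /pran /=; case eb: (ipf_fun e b) => [c|//] _.
by exists b; rewrite eb -(e_id _ _ eb).
Qed.

End GreenH.

(** * Subgroups and H-classes of an arbitrary semigroup *)

Section SemigroupIdeals.
Context {S : semigroupType}.
Implicit Types (a b e : S) (G : set S).

Lemma rideal_sub a b : rideal b a -> (rideal a `<=` rideal b)%classic.
Proof.
move=> ba c [->//|[s ->]]; right.
by case: ba => [->|[t ->]]; [exists s | exists (t * s)%g; rewrite mulgA].
Qed.

Lemma lideal_sub a b : lideal b a -> (lideal a `<=` lideal b)%classic.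
Proof.
move=> ba c [->//|[s ->]]; right.
by case: ba => [->|[t ->]]; [exists s | exists (s * t)%g; rewrite mulgA].
Qed.

Lemma greenH_ideals a b :
  rideal a b -> rideal b a -> lideal a b -> lideal b a -> greenH a b.
Proof.
move=> rab rba lab lba; split; apply/seteqP; split.
- exact: rideal_sub.
- exact: rideal_sub.
- exact: lideal_sub.
- exact: lideal_sub.
Qed.

(** Inverses make each element of [G] and the identity multiples of each other on both sides. *)
Lemma subgroup_sub_Hclass G :
  is_subgroup G -> exists2 e, (e * e)%g = e & (G `<=` Hclass e)%classic.
Proof.
move=> [_ [e Ge Gid]]; exists e; first by have [] := Gid _ Ge.
move=> a Ga; have [ea ae [b Gb [ab ba]]] := Gid _ Ga.
by apply: greenH_ideals; right; [exists a | exists b | exists a | exists b].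
Qed.

End SemigroupIdeals.

(** * H-classes as images of the symmetric group *)

Section HClasses.
Context {n : nat}.
Implicit Types (x y : n.-tupleprod posnat) (s t : 'S_n).

Lemma Hclass_perm_iso x y s :
  Hclass (perm_iso x y s) = range (perm_iso x y).
Proof.
apply/seteqP; split=> [b sb|_ [t _ <-]].
  have [t bt] := filter_isoE (greenH_filter_iso sb (filter_iso_perm x y s)).
  by exists t => //; apply: ipf_eqP.
(* One passes from [u] to [v] by multiplying by an automorphism of the target filter on the right,
   or of the source filter on the left. *)
have rid u v : rideal (perm_iso x y u) (perm_iso x y v).
  by right; exists (perm_iso y y (u^-1 * v)%g); rewrite perm_isoM mulKVg.
have lid u v : lideal (perm_iso x y u) (perm_iso x y v).
  by right; exists (perm_iso x x (v * u^-1)%g); rewrite perm_isoM mulgKV.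
exact: greenH_ideals.
Qed.

Lemma perm_iso_set_bij x y s :
  set_bij [set: 'S_n] (Hclass (perm_iso x y s)) (perm_iso x y).
Proof.
rewrite Hclass_perm_iso; split=> [t _|t u _ _|//]; first by exists t.
exact: perm_iso_inj.
Qed.

Lemma is_subgroup_Hclass x s : is_subgroup (Hclass (perm_iso x x s)).
Proof.
rewrite Hclass_perm_iso; split=> [_ _ [t _ <-] [u _ <-]|].
  by rewrite perm_isoM; exists (t * u)%g.
exists (perm_iso x x 1%g); first by exists 1%g.
move=> _ [t _ <-]; rewrite !perm_isoM mul1g mulg1; split=> //.
exists (perm_iso x x t^-1%g); first by exists t^-1%g.
by rewrite !perm_isoM mulgV mulVg.
Qed.

End HClasses.

(** * Cardinality of H-classes and identification of maximal subgroups *)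

Lemma card_eq_finType (T : finType) : [set: T] #= `I_#|T|.
Proof.
rewrite (card_eqr card_II) card_eq_sym.
have <- : range (@enum_rank T) = setT.
  by apply/seteqP; split=> // i _; exists (enum_val i); rewrite ?enum_valK.
by apply: inj_card_eq => x y _ _; apply: enum_rank_inj.
Qed.

Theorem corollary2p6 (n : nat) (n_gt0 : (0 < n)%N) :
  (forall G : set (IPF n), is_maximal_subgroup G -> isomorphic_to G 'S_n) /\
  (forall a : IPF n, Hclass a #= `I_(n`!)).
Proof.
split=> [G [Ggrp Gmax]|a].
  have [e ee Ge] := subgroup_sub_Hclass Ggrp.
  have [x exx] := ipf_idem ee; have [s es] := filter_isoE exx.
  have {}es : e = perm_iso x x s by apply: ipf_eqP.
  (* The H-class of [e] is a subgroup containing [G], so maximality makes them equal. *)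
  rewrite es in Ge; rewrite -(Gmax _ (is_subgroup_Hclass x s) Ge).
  exists (perm_iso x x); split=> [t u|]; first by rewrite perm_isoM.
  exact: perm_iso_set_bij.
have [x [y [s ->]]] := perm_isoE a.
rewrite Hclass_perm_iso -card_Sn -(card_eqr (card_eq_finType _)).
by apply: inj_card_eq => t u _ _; apply: perm_iso_inj.
Qed.
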